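(* Let $n_2,n_3,n_4,n_5,m,w$ be nonnegative integers with $n_2$ even and $n_2\ge 2$. Suppose there are $n_2$ couples (a husband and one wife), $n_3$ triples (a husband and two wives), $n_4$ quadruples (a husband and three wives), $n_5$ pentuples (a husband and four wives), $m$ single men and $w$ single women. The number of ways to seat all these persons around a circular table such that (1) all members of each family sit together, (2) no man sits adjacent to a woman except his own wife/wives, and (3) every husband having more than one wife is surrounded by his wives, is $$(1\cdot 2!)^{n_3}(2\cdot 3!)^{n_4}(3\cdot 4!)^{n_5}\cdot \frac{n_2!}{\left(\frac{n_2}{2}\right)!}\cdot \frac{\left(\frac{n_2}{2}+m-1\right)!}{\left(\frac{n_2}{2}-1\right)!}\cdot \left(\frac{n_2}{2}+n_3+n_4+n_5+w-1\right)!.$$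
   Context: All persons are distinguishable. Every person belongs to exactly one family (couple, triple, quadruple or pentuple) or is a single man or a single woman. The circular table has exactly as many seats as there are persons, and each person occupies one seat. Two seatings are regarded as the same if and only if one is obtained from the other by a rotation of the table; opposite orientations (mirror images) are counted as different. ''Adjacent'' means occupying cyclically neighbouring seats. Condition (1), ''all members of a family sit together'', means that the members of each family occupy a set of cyclically consecutive seats. Condition (2) means that whenever a man and a woman are adjacent, the woman is a wife of that man (so in particular single men are never adjacent to a woman, and single women are never adjacent to a man). Condition (3), ''surrounded by his wives'', means that both neighbours of such a husband are his own wives. *)

(* Defs.v *)
From HB Require Import structures.
From mathcomp Require Import all_boot.

Set Implicit Arguments.
Unset Strict Implicit.
Unset Printing Implicit Defensive.

(* Persons attached to a finite type F of families, the family f consisting of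
   one husband and nw f wives, together with m single men and w single women. *)
Inductive person (F : finType) (nw : F -> nat) (m w : nat) : Type :=
| Husband of F
| Wife (f : F) of 'I_(nw f)
| SingleMan of 'I_m
| SingleWoman of 'I_w.

Arguments Husband {F nw m w}.
Arguments Wife {F nw m w}.
Arguments SingleMan {F nw m w}.
Arguments SingleWoman {F nw m w}.

Definition person_code (F : finType) (nw : F -> nat) (m w : nat)
    (p : person nw m w) : (F + {f : F & 'I_(nw f)}) + ('I_m + 'I_w) :=
  match p with
  | Husband f => inl (inl f)
  | Wife f i => inl (inr (Tagged (fun f => 'I_(nw f)) i))
  | SingleMan i => inr (inl i)
  | SingleWoman i => inr (inr i)
  end.

Definition person_decode (F : finType) (nw : F -> nat) (m w : nat)
    (c : (F + {f : F & 'I_(nw f)}) + ('I_m + 'I_w)) : person nw m w :=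
  match c with
  | inl (inl f) => Husband f
  | inl (inr u) => Wife (tag u) (tagged u)
  | inr (inl i) => SingleMan i
  | inr (inr i) => SingleWoman i
  end.

Lemma person_codeK (F : finType) (nw : F -> nat) (m w : nat) :
  cancel (@person_code F nw m w) (@person_decode F nw m w).
Proof. by case. Qed.

HB.instance Definition _ (F : finType) (nw : F -> nat) (m w : nat) :=
  Finite.copy (person nw m w) (can_type (@person_codeK F nw m w)).

Definition is_man (F : finType) (nw : F -> nat) (m w : nat)
    (p : person nw m w) : bool :=
  match p with Husband _ | SingleMan _ => true | _ => false end.

Definition is_woman (F : finType) (nw : F -> nat) (m w : nat)
    (p : person nw m w) : bool := ~~ is_man p.

Definition wife_of (F : finType) (nw : F -> nat) (m w : nat)
    (q p : person nw m w) : bool :=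
  match p, q with Husband f, Wife g _ => g == f | _, _ => false end.

Definition in_family (F : finType) (nw : F -> nat) (m w : nat)
    (f : F) (p : person nw m w) : bool :=
  match p with Husband g => g == f | Wife g _ => g == f | _ => false end.

(* The seats of the round table are 'I_#|P|, the seat next to i being ordS i
   (successor modulo #|P|); a seating sends each person to his or her seat and
   is required below to be injective, hence bijective. *)
Definition seating (P : finType) := {ffun P -> 'I_#|P|}.

Definition same_up_to_rotation (P : finType) (s t : seating P) : bool :=
  [exists k : 'I_#|P|, [forall p, t p == iter k (@ordS _) (s p)]].

Definition adjacent (P : finType) (s : seating P) (p q : P) : bool :=
  (s q == ordS (s p)) || (s p == ordS (s q)).

Definition consecutive_seats (n : nat) (A : {set 'I_n}) : bool :=
  [exists a : 'I_n, A == [set iter (val j) (@ordS n) a | j : 'I_#|A|]].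

Definition families_together (F : finType) (nw : F -> nat) (m w : nat)
    (s : seating (person nw m w)) : bool :=
  [forall f : F, consecutive_seats [set s p | p in [set p | in_family f p]]].

Definition only_next_to_own_wives (F : finType) (nw : F -> nat) (m w : nat)
    (s : seating (person nw m w)) : bool :=
  [forall p, forall q,
     [&& is_man p, is_woman q & adjacent s p q] ==> wife_of q p].

Definition husbands_surrounded (F : finType) (nw : F -> nat) (m w : nat)
    (s : seating (person nw m w)) : bool :=
  [forall f : F, (1 < nw f) ==>
     [forall q, adjacent s (Husband f) q ==> wife_of q (Husband f)]].

Definition admissible_seatings (F : finType) (nw : F -> nat) (m w : nat) :
    {set seating (person nw m w)} :=
  [set s : seating (person nw m w) |
     [&& injectiveb s, families_together s, only_next_to_own_wives s
       & husbands_surrounded s]].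

Definition nb_seatings (F : finType) (nw : F -> nat) (m w : nat) : nat :=
  #|equivalence_partition (@same_up_to_rotation (person nw m w))
      (admissible_seatings nw m w)|.

(* Couples, triples, quadruples and pentuples, in this order. *)
Definition household (n2 n3 n4 n5 : nat) : finType :=
  ('I_n2 + 'I_n3 + 'I_n4 + 'I_n5)%type.

Definition nb_wives (n2 n3 n4 n5 : nat) (f : household n2 n3 n4 n5) : nat :=
  match f with
  | inl (inl (inl _)) => 1
  | inl (inl (inr _)) => 2
  | inl (inr _) => 3
  | inr _ => 4
  end.

(* Main.v *)
Require Import Defs.
From mathcomp Require Import all_boot zify.

Set Implicit Arguments.
Unset Strict Implicit.
Unset Printing Implicit Defensive.

(** Fix a couple c0. Every rotation class contains exactly one seating in which
    c0 occupies the seats 0 and 1, so it suffices to count the linear orders of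
    all persons that start with c0, whose cyclically consecutive members are
    compatible, and in which no family is left before it is complete. Once such
    an order has left a family, the number of its completions depends only on
    the sex of the last person placed and on the numbers of couples (a), men's
    blocks and women's blocks (single women and families with several wives)
    still to be placed. Choosing the next person gives a recurrence, which is
    solved by a! times two falling factorials: each couple switches between men
    and women, which fixes the number of runs of men's and of women's blocks,
    and the blocks are distributed in order over these runs. *)

(** * Lists in which each kinship class is contiguous *)

Lemma card_cons_tuple (T : finType) (n : nat) (Q : T -> pred (seq T)) :
  #|[set t : n.+1.-tuple T | Q (thead t) (behead t)]| =
  \sum_y #|[set t : n.-tuple T | Q y t]|.
Proof.
rewrite -sum1_card (partition_big (fun t => thead t) xpredT) //=.
apply: eq_bigr => y _.
rewrite -(card_imset _ (f := fun t : n.-tuple T => [tuple of y :: t])).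
  rewrite -sum1_card; apply: eq_bigl => t; rewrite inE.
  apply/andP/imsetP => [[Qt /eqP <-]|[u]].
    exists [tuple of behead t]; first by rewrite inE.
    by apply: val_inj; case/tupleP: t {Qt} => z t; rewrite theadE.
  by rewrite inE => Qu ->; rewrite theadE.
by move=> u v /(congr1 (@tval _ _)) [] uv; apply: val_inj.
Qed.

Section Completions.

Variables (T : finType) (compat kin : rel T).

(** A person with a relative further on must be followed by a relative at once; for an equivalence
    relation this makes the classes contiguous. The default of [head] is never reached when the
    premise holds. *)
Fixpoint grouped (s : seq T) : bool :=
  if s is x :: s' then (has (kin x) s' ==> kin x (head x s')) && grouped s'
  else true.

(** [x] is the person placed most recently, [R] the set of those still to come, and [last] the
    neighbour that closes the circle. What precedes [x] is forgotten. *)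
Definition completion (last : T) (R : {set T}) (x : T) (t : seq T) : bool :=
  [&& uniq t, [set:: t] == R, path compat x (rcons t last) & grouped (x :: t)].

Definition nb_completions (last : T) (R : {set T}) (x : T) : nat :=
  #|[set t : #|R|.-tuple T | completion last R x t]|.

Definition next_ok (R : {set T}) (x y : T) : bool :=
  compat x y && ([exists z in R, kin x z] ==> kin x y).

Lemma nb_completions0 (last x : T) :
  nb_completions last set0 x = compat x last.
Proof.
rewrite /nb_completions cards0.
rewrite (@eq_card _ _ (fun _ => compat x last)); last first.
  move=> t; rewrite [t]tuple0 inE /completion /= !andbT; rewrite unfold_in.
  by rewrite set_nil eqxx.
case: (compat x last); last exact: eq_card0.
by rewrite (eq_card (B := {: 0.-tuple T})) // card_tuple expn0.
Qed.

(** Completions are classified by their first element [y]. Since their elements are exactly those of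
    [R], the condition of [grouped] at [x] depends on [R] and [y] only, which is [next_ok]. *)
Lemma nb_completionsS (last x : T) (R : {set T}) : R != set0 ->
  nb_completions last R x =
  \sum_(y in R | next_ok R x y) nb_completions last (R :\ y) y.
Proof.
rewrite /nb_completions => Rn0.
have [n Rn] : exists n, #|R| = n.+1.
  by exists #|R|.-1; rewrite prednK // card_gt0.
rewrite Rn.
pose Q y (t : seq T) := completion last R x (y :: t).
transitivity #|[set t : n.+1.-tuple T | Q (thead t) (behead t)]|.
  by apply: eq_card => t; rewrite !inE; case/tupleP: t => y t; rewrite theadE.
rewrite card_cons_tuple [RHS]big_mkcond /=; apply: eq_bigr => y _.
have Q_cons (t : seq T) :
    Q y t = [&& y \in R, next_ok R x y & completion last (R :\ y) y t].
  rewrite /Q /completion /next_ok /= set_cons.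
  have [tR|tR] := eqVneq (y |: [set:: t]) R; last first.
    rewrite andbF; apply/esym/negP => /and3P[yR _ /and4P[_ /eqP tE _ _]].
    by case/negP: tR; rewrite tE setD1K.
  have yR : y \in R by rewrite -tR setU11.
  have -> : [exists z in R, kin x z] = kin x y || has (kin x) t.
    apply/existsP/orP => [[z /andP[]]|[xy|/hasP[z zt xz]]].
    - rewrite -tR !inE => /orP[/eqP-> ->|zt xz]; first by left.
      by right; apply/hasP; exists z.
    - by exists y; rewrite yR.
    - by exists z; rewrite xz -tR !inE zt orbT.
  rewrite yR /=.
  have [yt|yt] := boolP (y \in t) => /=.
    have -> : ([set:: t] == R :\ y) = false.
      by apply/negP => /eqP/setP/(_ y); rewrite !inE yt eqxx.
    by rewrite !andbF.
  have -> : [set:: t] == R :\ y.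
    rewrite -tR; apply/eqP/setP => z; rewrite !inE.
    by case: eqP => // ->; rewrite (negbTE yt).
  case: (uniq t); case: (compat x y); case: (_ ==> _);
    by rewrite ?andbF //= ?andbT.
have [yR|yR] := boolP (y \in R); last first.
  by rewrite /= eq_card0 // => t; rewrite !inE Q_cons (negbTE yR).
have [ok|nok] := boolP (next_ok R x y); last first.
  by rewrite /= eq_card0 // => t; rewrite !inE Q_cons (negbTE nok) andbF.
have -> : n = #|R :\ y| by move: Rn; rewrite (cardsD1 y) yR => -[].
by rewrite /=; apply: eq_card => t; rewrite !inE Q_cons yR ok.
Qed.

End Completions.

(** This indexed form of contiguity has the shape of [convex_seats], so that lists can be compared
    with seatings. *)
Lemma groupedP (T : finType) (kin : rel T) (x0 : T) (s : seq T) :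
  reflect (forall i j, i < j < size s -> kin (nth x0 s i) (nth x0 s j) ->
             kin (nth x0 s i) (nth x0 s i.+1)) (grouped kin s).
Proof.
elim: s => [|x s IH] /=; first by left=> i j; rewrite ltn0 andbF.
apply: (iffP andP) => [[/implyP xs /IH gs] [|i] [|j] //= ij|gs].
- by move=> xj; rewrite nth0 [head _ _](_ : _ = head x s);
     [apply/xs/(has_nthP x0); exists j | case: (s) ij].
- exact: gs.
split.
  apply/implyP => /(has_nthP x0)[j js xj].
  by have := gs 0 j.+1 js xj; rewrite /= nth0; case: (s) js.
by apply/IH => i j ij; apply: (gs i.+1 j.+1).
Qed.

(** * Seats of a round table *)

Lemma val_iter_ordS (n k : nat) (i : 'I_n) :
  iter k (@ordS n) i = (i + k) %% n :> nat.
Proof.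
elim: k => [|k IH] /=; first by rewrite addn0 modn_small.
by rewrite IH -addn1 modnDml addn1 addnS.
Qed.

Definition convex_seats (n : nat) (A : {set 'I_n}) : Prop :=
  forall i j k : 'I_n,
    i \in A -> j \in A -> i < j -> k = i.+1 :> nat -> k \in A.

Lemma convex_consecutive (n : nat) (A : {set 'I_n}) :
  A != set0 -> convex_seats A -> consecutive_seats A.
Proof.
case/set0Pn=> i0 i0A cA.
case: (arg_minnP (fun i : 'I_n => val i) i0A) => a aA amin.
have seat j : j < #|A| -> exists2 k : 'I_n, k \in A & k = a + j :> nat.
  elim: j => [_|j IH jA]; first by exists a; rewrite ?addn0.
  have [k kA kE] := IH (ltnW jA).
  (* If [k] were the last member, [A] would lie in the [j.+1] numbers from [a] to [a + j], against
     [j.+1 < #|A|]. *)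
  have [b bA kb] : exists2 b, b \in A & k < b.
    apply/exists_inP; apply: contraLR jA => /exists_inPn kmax.
    rewrite -leqNgt cardE -(size_map val) -(size_iota a j.+1).
    apply: uniq_leq_size.
      by rewrite map_inj_uniq ?enum_uniq //; apply: val_inj.
    move=> v /mapP[b]; rewrite mem_enum => bA ->; rewrite mem_iota.
    by move: (kmax b bA) (amin b bA) => /=; rewrite kE; lia.
  have kn : k.+1 < n by apply: leq_ltn_trans kb (ltn_ord b).
  by exists (Ordinal kn); rewrite /= ?kE ?addnS //; apply: cA kA bA kb _.
have seatE (j : 'I_#|A|) : iter j (@ordS n) a = a + j :> nat.
  rewrite val_iter_ordS modn_small //.
  by have [k _ <-] := seat _ (ltn_ord j).
apply/existsP; exists a; rewrite eq_sym eqEcard; apply/andP; split.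
  apply/subsetP => _ /imsetP[j _ ->]; have [k kA kE] := seat _ (ltn_ord j).
  by rewrite (_ : iter _ _ _ = k) //; apply: val_inj; rewrite /= seatE kE.
rewrite card_imset ?cardsT ?card_ord // => j j' /(congr1 val).
by rewrite /= !seatE => /addnI /val_inj.
Qed.

Lemma consecutive_convex (n : nat) (A : {set 'I_n}) :
    (forall i j : 'I_n,
       i = 0 :> nat -> j.+1 = n -> ~~ ((i \in A) && (j \in A))) ->
  consecutive_seats A -> convex_seats A.
Proof.
move=> ends /existsP[a /eqP AE].
have memA i :
    (i \in A) = (i < n) && has (fun j => (a + j) %% n == i) (iota 0 #|A|).
  rewrite ltn_ord {1}AE; apply/imsetP/hasP => [[j _ ->]|[j]].
    by exists (val j); rewrite ?mem_iota /= ?ltn_ord // val_iter_ordS.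
  rewrite mem_iota => /= jA /eqP ji; exists (Ordinal jA) => //.
  by apply: val_inj; rewrite /= val_iter_ordS.
have memAP i j : j < #|A| -> (a + j) %% n = i ->
    forall k : 'I_n, k = i :> nat -> k \in A.
  move=> jA ij k ki; rewrite memA ltn_ord; apply/hasP; exists j.
    by rewrite mem_iota.
  by rewrite ij ki.
have n_gt0 : 0 < n := leq_ltn_trans (leq0n _) (ltn_ord a).
have an := ltn_ord a.
(* A wrapping arc would reach the last seat at offset [n.-1 - a] and seat 0 at offset [n - a], which
   [ends] excludes. *)
have nowrap : a + #|A| <= n.
  rewrite leqNgt; apply/negP => wrap.
  have n1 : n.-1 < n by rewrite prednK.
  case/negP: (ends (Ordinal n_gt0) (Ordinal n1) erefl (prednK n_gt0)).
  apply/andP; split.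
    apply: (memAP 0 (n - a)) => //; first lia.
    by rewrite subnKC ?modnn // ltnW.
  apply: (memAP n.-1 (n.-1 - a)) => //; first lia.
  by rewrite subnKC ?modn_small //; lia.
have interval (i : 'I_n) : (i \in A) = (a <= i < a + #|A|).
  apply/idP/idP => [|/andP[ai iA]].
    rewrite memA => /andP[_ /hasP[j]]; rewrite mem_iota => /= jA /eqP <-.
    rewrite modn_small ?leq_addr ?ltn_add2l //.
    by apply: leq_trans nowrap; rewrite ltn_add2l.
  by apply: (memAP i (i - a)) => //; [lia | rewrite subnKC ?modn_small].
move=> i j k; rewrite !interval => iA jA ij kE; lia.
Qed.

Lemma cycle_tupleP (T : Type) (e : rel T) (n : nat) (t : n.-tuple T) :
  reflect (forall i, e (tnth t i) (tnth t (ordS i))) (cycle e t).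
Proof.
case: n t => [|n] t; first by rewrite [t]tuple0; left; case.
case/tupleP: t => x t /=.
have nthE (i : 'I_n.+1) : nth x (x :: rcons t x) i = tnth [tuple of x :: t] i.
  by rewrite (tnth_nth x) -rcons_cons nth_rcons /= size_tuple ltn_ord.
have nthSE (i : 'I_n.+1) :
    nth x (rcons t x) i = tnth [tuple of x :: t] (ordS i).
  rewrite (tnth_nth x) nth_rcons size_tuple /=.
  have [i_lt|] := ltnP i n; first by rewrite modn_small.
  rewrite leq_eqVlt ltnNge -ltnS ltn_ord orbF => /eqP <-.
  by rewrite eqxx modnn.
apply: (iffP (pathP x)) => [et i|et i].
  by rewrite -nthE -nthSE; apply: et; rewrite size_rcons size_tuple.
rewrite size_rcons size_tuple => i_lt.
by rewrite (nthE (Ordinal i_lt)) (nthSE (Ordinal i_lt)).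
Qed.

(** * Rotations of a seating *)

Lemma iter_ordS_inj (n k : nat) : injective (iter k (@ordS n)).
Proof. by elim: k => [|k IH] i j //= /(@ordS_inj n)/IH. Qed.

Section Rotation.

Variable P : finType.

Implicit Types (s t : seating P) (p q : P) (k l : nat).

Definition rotate s k : seating P := [ffun p => iter k (@ordS _) (s p)].

Lemma val_rotate s k p : rotate s k p = (s p + k) %% #|P| :> nat.
Proof. by rewrite ffunE val_iter_ordS. Qed.

Lemma rotateD s k l : rotate (rotate s k) l = rotate s (k + l).
Proof.
apply/ffunP => p; apply: ord_inj.
by rewrite !val_rotate modnDml addnA.
Qed.

Lemma rotate_id s k : #|P| %| k -> rotate s k = s.
Proof.
case/dvdnP => c ->; apply/ffunP => p; apply: ord_inj.
by rewrite val_rotate addnC modnMDl modn_small.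
Qed.

Lemma rotate_mod s k : rotate s (k %% #|P|) = rotate s k.
Proof. by apply/ffunP => p; apply: ord_inj; rewrite !val_rotate modnDmr. Qed.

Lemma rotate_back s k : exists l, rotate (rotate s k) l = s.
Proof.
(* Together with [k] this makes a multiple of [#|P|], a whole number of turns. *)
exists (k * #|P|.-1); rewrite rotateD; apply/ffunP => p; apply: ord_inj.
have P_gt0 : 0 < #|P| := leq_ltn_trans (leq0n _) (ltn_ord (s p)).
by rewrite val_rotate -mulnS prednK // addnC modnMDl modn_small.
Qed.

Lemma same_up_to_rotationP s t : 0 < #|P| ->
  reflect (exists k, t = rotate s k) (same_up_to_rotation s t).
Proof.
move=> P_gt0; apply: (iffP existsP) => [[k /forallP st]|[k ->]].
  by exists k; apply/ffunP => p; rewrite ffunE; apply/eqP/st.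
exists (Ordinal (ltn_pmod k P_gt0)); apply/forallP => p; apply/eqP => /=.
by rewrite -[RHS](ffunE (fun p => iter _ _ (s p))) -/(rotate _ _) rotate_mod.
Qed.

Lemma same_up_to_rotation_equiv : 0 < #|P| ->
  equivalence_rel (@same_up_to_rotation P).
Proof.
move=> P_gt0; have sameP := same_up_to_rotationP _ _ P_gt0.
move=> s t u; split; first by apply/sameP; exists 0; rewrite rotate_id.
case/sameP => k ->; have [l kl] := rotate_back s k.
apply/sameP/sameP => -[j ->]; last by exists (k + j); rewrite rotateD.
by exists (l + j); rewrite -rotateD kl.
Qed.

Lemma adjacent_rotate s k p q : adjacent (rotate s k) p q = adjacent s p q.
Proof.
by rewrite /adjacent !ffunE -!iterS !iterSr !(inj_eq (@iter_ordS_inj _ k)).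
Qed.

Lemma adjacentC s p q : adjacent s p q = adjacent s q p.
Proof. exact: orbC. Qed.

Lemma consecutive_rotate s k (A : {set P}) :
  consecutive_seats (s @: A) -> consecutive_seats (rotate s k @: A).
Proof.
case/existsP=> a /eqP sA; apply/existsP; exists (iter k (@ordS _) a).
have rotE : rotate s k @: A = [set iter k (@ordS _) i | i in s @: A].
  by rewrite -imset_comp; apply: eq_imset => p; rewrite ffunE.
have -> : #|rotate s k @: A| = #|s @: A|.
  by rewrite rotE card_imset //; apply: iter_ordS_inj.
apply/eqP; rewrite rotE {1}sA -imset_comp; apply: eq_imset => j /=.
by rewrite -!iterD addnC.
Qed.

End Rotation.

(** * Counting completions *)

(* Number of ways to arrange a couples and two kinds of blocks, o of the kind
   allowed next and u of the other kind, each couple switching between the two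
   kinds: there remain a./2.+1 runs of the first kind (the current one included)
   and uphalf a runs of the second kind. *)
Definition alternations (a o u : nat) : nat :=
  a`! * (a./2 + o) ^_ o * (uphalf a + u).-1 ^_ u.

(** [(p + b) ^_ b] counts the ways to distribute [b] distinguishable blocks, in order, over [p.+1]
    runs: either the first run is empty, or it starts with one of the [b] blocks. *)
Lemma runs_rec (p b : nat) :
  (p + b) ^_ b = (p + b).-1 ^_ b + b * (p + b).-1 ^_ b.-1.
Proof.
case: b => [|b]; first by rewrite !ffactn0.
rewrite addnS ffactSS /= ffactnSr addnK.
by rewrite [_ * p]mulnC -mulnDl addnS.
Qed.

(** If the current run ends here, one of the [a] couples comes next and the two kinds exchange
    roles; otherwise one of the [o] blocks does. With nothing left the left side is 1 and the right
    side 0, whence the hypothesis. *)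
Lemma alternations_rec (a o u : nat) : 0 < a + o + u ->
  alternations a o u = a * alternations a.-1 u o + o * alternations a o.-1 u.
Proof.
move=> aou; rewrite /alternations runs_rec mulnDr mulnDl.
have -> : o * (a`! * (a./2 + o.-1) ^_ o.-1 * (uphalf a + u).-1 ^_ u) =
          a`! * (o * (a./2 + o).-1 ^_ o.-1) * (uphalf a + u).-1 ^_ u.
  case: o {aou} => [|o]; first by rewrite !(mul0n, muln0).
  rewrite [a./2 + o.+1]addnS [o.+1.-1]/= [_.+1.-1]/=.  lia.
congr (_ + _); case: a aou => [|a] /=; last first.
  by rewrite factS; lia.
(* Without couples the first summand must vanish: one of the falling factorials has more factors
   than its base. *)
rewrite mul0n !add0n.
case: o => [|o]; last by rewrite (ffact_small (leqnn _)) muln0.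
by case: u => [|u] // _; rewrite (ffact_small (leqnn _)) muln0.
Qed.

Arguments wife_of {F nw m w} !q !p : simpl nomatch.
Arguments in_family {F nw m w} f !p : simpl nomatch.

Section Counting.

Variables (F : finType) (nw : F -> nat) (m w : nat).
Hypothesis nw_gt0 : forall f, 0 < nw f.

Local Notation person := (person nw m w).

Implicit Types (p q x y : person) (f g : F) (R : {set person}).

Definition big_husband p := if p is Husband f then 1 < nw f else false.

(* Conditions (2) and (3) combined into one symmetric relation on neighbours. *)
Definition compatible p q : bool :=
  [&& (is_man p != is_man q) ==> wife_of p q || wife_of q p,
      big_husband p ==> wife_of q p & big_husband q ==> wife_of p q].

(** Single persons are kin to nobody, not even to themselves, so that [grouped] asks nothing of
    them. *)
Definition kin p q : bool :=
  match p with
  | Husband f | Wife f _ => in_family f q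
  | _ => false
  end.

Lemma big_person (P : pred person) (G : person -> nat) :
  \sum_(p | P p) G p =
    \sum_(f | P (Husband f)) G (Husband f)
  + \sum_f \sum_(i < nw f | P (Wife f i)) G (Wife f i)
  + \sum_(i < m | P (SingleMan i)) G (SingleMan i)
  + \sum_(i < w | P (SingleWoman i)) G (SingleWoman i).
Proof.
have dec_bij : bijective (@person_decode F nw m w).
  by exists (@person_code F nw m w); [case=> [[f|[f i]]|[i|i]]|case].
rewrite (reindex _ (onW_bij _ dec_bij)) !big_sumType /= addnA.
congr (_ + _ + _ + _).
by rewrite (sig_big_dep (fun=> true) (fun f i => P (Wife f i))
  (fun f i => G (Wife f i))).
Qed.

Lemma wife_in_family f p : wife_of p (Husband f) -> in_family f p.
Proof. by case: p. Qed.

Lemma wife_ofP f p : wife_of p (Husband f) -> exists i, p = Wife f i.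
Proof. by case: p => // g i /eqP gf; subst g; exists i. Qed.

Lemma compatible_wife f p q : in_family f p -> wife_of q (Husband f) ->
  compatible p q.
Proof.
by case: p => [g|g i|i|i] // /eqP <- /wife_ofP[j ->];
  rewrite /compatible /= ?eqxx ?implybT.
Qed.

Lemma in_familyP f p :
  in_family f p = (p == Husband f) || wife_of p (Husband f).
Proof.
by case: p => [g|g i|i|i] //=; rewrite ?orbF.
Qed.

Lemma in_family_kin f p : in_family f p -> kin p =1 in_family f.
Proof. by case: p => [g|g i|i|i] //= /eqP <-. Qed.

Definition outside R f : {set person} := [set p in R | ~~ in_family f p].
Definition wives_in R f : {set person} := [set p in R | wife_of p (Husband f)].

Lemma outsideD1 R f y : in_family f y -> outside (R :\ y) f = outside R f.
Proof.
move=> fy; apply/setP => p; rewrite !inE; case: eqP => //= ->.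
by rewrite fy andbF.
Qed.

(** * Completing a family that has been entered *)

Section Last.

Variable x0 : person.

Local Notation C := (nb_completions compatible kin x0).

Lemma family_open R f x : in_family f x -> outside R f != R ->
  R != set0 /\ [exists z in R, kin x z].
Proof.
move=> fx /eqP out; have [z zR fz] : exists2 z, z \in R & in_family f z.
  apply/exists_inP; apply: contra_notT out => /exists_inPn nR.
  apply/setP => p; rewrite inE; case: (boolP (p \in R)) => //= pR.
  by rewrite nR.
split; first by apply/set0Pn; exists z.
by apply/existsP; exists z; rewrite zR (in_family_kin fx).
Qed.

Lemma nb_completions_open R f x : in_family f x -> outside R f != R ->
  C R x = \sum_(y in R | compatible x y && in_family f y) C (R :\ y) y.
Proof.
move=> fx /(family_open fx) [Rn0 op]; rewrite nb_completionsS //.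
apply: eq_bigl => y; congr (_ && _).
by rewrite /next_ok op /= (in_family_kin fx).
Qed.

Lemma outside_cases R f : Husband f \notin R -> wives_in R f = set0 ->
  outside R f = R.
Proof.
move=> hR wR; apply/setP => p; rewrite inE.
case: (boolP (p \in R)) => //= pR; rewrite in_familyP negb_or.
rewrite (contraNneq _ hR) => [|<- //] /=.
by apply/negP => wp; move/setP/(_ p): wR; rewrite !inE pR wp.
Qed.

Lemma wives_inD1 R f y : y \in wives_in R f ->
  #|wives_in R f| = #|wives_in (R :\ y) f|.+1.
Proof.
move=> yw; rewrite (cardsD1 y) yw add1n; congr _.+1.
by apply: eq_card => p; rewrite !inE andbA.
Qed.

Lemma outside_neq R f y : y \in R -> in_family f y -> outside R f != R.
Proof. by move=> yR fy; apply/eqP => /setP/(_ y); rewrite inE yR fy. Qed.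

(** Once the husband is placed, the remaining wives may follow in any order. The disjunction ensures
    that the family is left at a wife even if [x] is the husband; which wife this is does not affect
    [K]. *)
Lemma nb_completions_wives R f x K :
    Husband f \notin R -> x \notin R -> in_family f x ->
    wife_of x (Husband f) || (wives_in R f != set0) ->
    (forall i, C (outside R f) (Wife f i) = K) ->
  C R x = #|wives_in R f|`! * K.
Proof.
move=> hR xR fx okx HK.
move: {2}#|_| (erefl #|wives_in R f|) => n.
elim: n R x hR xR fx okx HK => [|n IH] R x hR xR fx okx HK wn.
  rewrite wn fact0 mul1n; move/eqP: wn; rewrite cards_eq0 => /eqP wn.
  move: okx; rewrite wn eqxx orbF => xw.
  case: x xw {fx xR} => // g i /eqP gf; subst g.
  by rewrite -[R in LHS](outside_cases hR wn) HK.
have [y yw] : exists y, y \in wives_in R f.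
  by apply/set0Pn; rewrite -card_gt0 wn.
have := yw; rewrite inE => /andP[yR fy].
rewrite (nb_completions_open fx);
  last exact: outside_neq yR (wife_in_family fy).
rewrite (eq_bigl (mem (wives_in R f))); last first.
  move=> z; rewrite !inE; case: (boolP (z \in R)) => //= zR.
  have zh : z != Husband f by apply: contraNneq hR => <-.
  rewrite in_familyP (negbTE zh) /=.
  case wz: (wife_of z (Husband f)); rewrite ?andbF // andbT.
  exact: compatible_wife wz.
rewrite (eq_bigr (fun=> n`! * K)).
  by rewrite sum_nat_const wn factS mulnA.
move=> z zw; have wzn : #|wives_in (R :\ z) f| = n.
  by move: (wives_inD1 zw); rewrite wn => -[].
have := zw; rewrite !inE => /andP[zR fz].
rewrite IH ?wzn //.
- by rewrite !inE negb_and hR orbT.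
- by rewrite !inE eqxx.
- exact: wife_in_family.
- by rewrite fz.
- by rewrite outsideD1 //; exact: wife_in_family.
Qed.

(** A husband with several wives needs a wife as his next neighbour, but none is left in [R] and the
    closing person [x0] is not one either. *)
Lemma nb_completions_widowed R f : 1 < nw f -> Husband f \notin R ->
  ~~ in_family f x0 -> wives_in R f = set0 -> C R (Husband f) = 0.
Proof.
move=> f1 hR x0f wR.
have no_wife y : y \in x0 |: R -> compatible (Husband f) y = false.
  move=> yR; apply/negP; rewrite /compatible /= f1 /= => /and3P[_ wy _].
  move: yR; rewrite !inE => /orP[/eqP yx|yR].
    by case/negP: x0f; rewrite -yx; apply: wife_in_family.
  by move/setP/(_ y): wR; rewrite !inE yR wy.
have [->|Rn0] := eqVneq R set0.
  by rewrite nb_completions0 no_wife // setU11.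
rewrite nb_completionsS // big1 // => y /andP[yR].
by rewrite /next_ok no_wife // inE yR orbT.
Qed.

(** The remaining wives come in any order, and the husband goes directly before one of them, never
    after all. In the induction the next person is either the husband or one of these wives. *)
Lemma nb_completions_family R f x K : 1 < nw f -> ~~ in_family f x0 ->
    Husband f \in R -> x \notin R -> wife_of x (Husband f) ->
    (forall i, C (outside R f) (Wife f i) = K) ->
  C R x = #|wives_in R f| * #|wives_in R f|`! * K.
Proof.
move=> f1 x0f hR xR fx HK.
move: {2}#|_| (erefl #|wives_in R f|) => n.
elim: n R x hR xR fx HK => [|n IH] R x hR xR fx HK wn.
all: rewrite (nb_completions_open (wife_in_family fx)); last first.
1,3: by apply: outside_neq hR _; rewrite /= eqxx.
all: rewrite (bigD1 (Husband f)) /=; last first.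
1,3: rewrite hR eqxx andbT /compatible /= f1 fx !implybT /= andbT.
1,2: by case: x fx {xR} => //= g i; rewrite eqxx implybT.
all: have wh : wives_in (R :\ Husband f) f = wives_in R f.
1,3: by apply/setP => p; rewrite !inE; case: eqP => //= ->; rewrite andbF.
all: have hh : Husband f \notin R :\ Husband f by rewrite !inE eqxx.
  (* Without further wives the husband is the only candidate, and placing him is a dead end. *)
  have w0 : wives_in R f = set0 by apply/eqP; rewrite -cards_eq0 wn.
  rewrite nb_completions_widowed ?wh // wn mul0n mul0n add0n big1 // => y.
  rewrite in_familyP => /andP[/and3P[yR _ /orP[-> //|wy]] _].
  by move/setP/(_ y): w0; rewrite !inE yR wy.
rewrite (nb_completions_wives (K := K) hh) //; first last.
- by move=> i; rewrite outsideD1 //= eqxx.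
- by rewrite wh -card_gt0 wn.
- by rewrite /= eqxx.
rewrite wh wn (eq_bigl (mem (wives_in R f))); last first.
  move=> z; rewrite !inE in_familyP.
  case: (eqVneq z (Husband f)) => [->|zh]; first by rewrite !andbF.
  case: (boolP (z \in R)) => //= zR.
  case wz: (wife_of z (Husband f)); rewrite ?andbF // !andbT.
  exact: compatible_wife (wife_in_family fx) wz.
rewrite (eq_bigr (fun=> n * n`! * K)).
  by rewrite sum_nat_const wn factS; nia.
move=> z zw; have wzn : #|wives_in (R :\ z) f| = n.
  by move: (wives_inD1 zw); rewrite wn => -[].
have := zw; rewrite !inE => /andP[zR fz].
rewrite IH ?wzn //.
- rewrite !inE hR andbT; apply/eqP => hz; by rewrite -hz in fz.
- by rewrite !inE eqxx.
- by rewrite outsideD1 //; exact: wife_in_family.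
Qed.

Lemma nb_completions_couple R f i x : nw f = 1 ->
    Husband f \in R -> x \notin R -> x = Wife f i ->
  C R x = C (outside R f) (Husband f).
Proof.
move=> f1 hR xR xE; have fx : in_family f x by rewrite xE /= eqxx.
rewrite (nb_completions_open fx); last first.
  by apply: outside_neq hR _; rewrite /= eqxx.
(* The only wife is [x], which is no longer in [R]. *)
have xu y : in_family f y -> y \in R -> y = Husband f.
  rewrite in_familyP => /orP[/eqP-> //|wy yR].
  case/negP: xR; suff <- : y = x by [].
  rewrite xE; case: y wy {yR} => //= g j /eqP gf; subst g; congr Wife.
  by apply: ord_inj; have := ltn_ord i; have := ltn_ord j; lia.
rewrite (big_pred1 (Husband f)) => [|y].
  congr (C _ _); apply/setP => p; rewrite !inE andbC.
  case: (boolP (p \in R)) => //= pR; congr (~~ _).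
  by apply/eqP/idP => [->|/xu->//]; rewrite /= eqxx.
apply/andP/eqP => [[yR /andP[_ /xu -> //]]|->].
by rewrite hR /= eqxx xE /compatible /= eqxx f1.
Qed.

End Last.

(** * Remaining persons as a union of blocks *)

(** This is the form of [R] between two blocks: each family is either still complete in it or
    entirely gone. *)
Definition blocks (A : {set F}) (M : {set 'I_m}) (V : {set 'I_w}) :
    {set person} :=
  [set p | match p with
           | Husband f => f \in A
           | Wife f _ => f \in A
           | SingleMan i => i \in M
           | SingleWoman i => i \in V
           end].

Definition couples (A : {set F}) := [set f in A | nw f == 1].
Definition bigs (A : {set F}) := [set f in A | 1 < nw f].

(* A family with j > 1 wives can be ordered in (j - 1) * j! ways with the
   husband strictly inside. *)
Definition weight (A : {set F}) := \prod_(f in bigs A) ((nw f).-1 * (nw f)`!).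

Implicit Types (A : {set F}) (M : {set 'I_m}) (V : {set 'I_w}).

Lemma outside_blocks A M V f p : in_family f p ->
  outside (blocks A M V :\ p) f = blocks (A :\ f) M V.
Proof.
move=> fp; rewrite outsideD1 //; apply/setP => q; rewrite !inE.
by case: q => [g|g i|i|i]; rewrite /= ?inE ?andbT // andbC.
Qed.

Lemma blocksD1_man A M V i : blocks A M V :\ SingleMan i = blocks A (M :\ i) V.
Proof. by apply/setP => -[?|? ?|?|?]; rewrite !inE /= ?inE. Qed.

Lemma blocksD1_woman A M V i :
  blocks A M V :\ SingleWoman i = blocks A M (V :\ i).
Proof. by apply/setP => -[?|? ?|?|?]; rewrite !inE /= ?inE. Qed.

Lemma couplesD1 A f : couples (A :\ f) = couples A :\ f.
Proof. by apply/setP => g; rewrite !inE andbA. Qed.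

Lemma bigsD1 A f : bigs (A :\ f) = bigs A :\ f.
Proof. by apply/setP => g; rewrite !inE andbA. Qed.

Lemma couple_notin_bigs A f : f \in couples A -> bigs A :\ f = bigs A.
Proof.
rewrite inE => /andP[_ /eqP f1]; apply/setP => g; rewrite !inE.
by case: eqP => // ->; rewrite f1 andbF.
Qed.

Lemma big_notin_couples A f : f \in bigs A -> couples A :\ f = couples A.
Proof.
rewrite inE => /andP[_ f1]; apply/setP => g; rewrite !inE.
by case: eqP => // ->; rewrite gtn_eqF ?andbF.
Qed.

Lemma weightD1 A f : f \in bigs A ->
  weight A = (nw f).-1 * (nw f)`! * weight (A :\ f).
Proof. by move=> fA; rewrite /weight (big_setD1 f) //= bigsD1. Qed.

Lemma weight_couple A f : f \in couples A -> weight (A :\ f) = weight A.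
Proof. by move=> fA; rewrite /weight bigsD1 couple_notin_bigs. Qed.

Lemma wives_in_blocks A M V f i : f \in A ->
  #|wives_in (blocks A M V :\ Wife f i) f| = (nw f).-1.
Proof.
move=> fA.
have -> : wives_in (blocks A M V :\ Wife f i) f
        = [set Wife f j | j in [set~ i]].
  apply/setP => p; apply/idP/imsetP => [|[j ji ->]].
    rewrite !inE -andbA => /and3P[pi _ /wife_ofP[j pE]]; exists j => //.
    by rewrite !inE; apply: contraNneq pi => <-; rewrite pE.
  rewrite !inE fA /= eqxx !andbT; move: ji; rewrite !inE.
  by apply: contraNneq => -[] /eqP; rewrite eq_Tagged.
rewrite card_imset ?cardsC1 ?card_ord // => j k [] /eqP.
by rewrite eq_Tagged => /eqP.
Qed.

Section BlockCount.

Variables (x0 : person) (c0 : F).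
Hypotheses (c0_couple : nw c0 = 1) (x0_c0 : in_family c0 x0).

Local Notation C := (nb_completions compatible kin x0).

Lemma not_in_family_last f : f != c0 -> ~~ in_family f x0.
Proof.
by move=> fc; case: x0 x0_c0 => [g|g i|i|i] //= /eqP->; rewrite eq_sym.
Qed.

(** Between different blocks nobody is a wife of the other. Condition (2) then forces equal sex, and
    condition (3) bars a big husband from the edge of his family. *)
Lemma compatible_across_blocks x y :
    ~~ big_husband x -> ~~ kin x y ->
  compatible x y = (is_man x == is_man y) && ~~ big_husband y.
Proof.
move=> hx kxy; rewrite /compatible (negbTE hx) /=.
have -> : wife_of x y = false.
  apply: contraNF kxy; case: x {hx} => [f|f i|i|i]; case: y => //= g.
  by rewrite eq_sym.
have -> : wife_of y x = false.
  by apply: contraNF kxy; case: x {hx} => [f|f i|i|i]; case: y.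
by case: (is_man x); case: (is_man y); case: (big_husband y).
Qed.

(** Big families count as women's blocks because they are entered and left at wives. The kind
    matching the sex of the last person placed comes first in [alternations]. *)
Definition block_count A M V (man : bool) :=
  weight A * if man then alternations #|couples A| #|M| (#|bigs A| + #|V|)
             else alternations #|couples A| (#|bigs A| + #|V|) #|M|.

(* The list must return to x0, and every couple switches the sex: hence the
   parity condition. *)
Definition at_boundary A M V x :=
  [&& x \notin blocks A M V, [forall f in A, ~~ in_family f x],
      ~~ big_husband x & (is_man x == is_man x0) (+) odd #|couples A|].

Lemma nb_completions_from_husband A M V f K : f \in couples A ->
    (forall i, C (blocks (A :\ f) M V) (Wife f i) = K) ->
  C (blocks A M V :\ Husband f) (Husband f) = K.
Proof.
rewrite inE => /andP[fA /eqP f1] HK.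
have fH : in_family f (Husband f : person) by rewrite /= eqxx.
have wE : wives_in (blocks A M V :\ Husband f) f = wives_in (blocks A M V) f.
  by apply/setP => p; rewrite !inE; case: eqP => //= ->; rewrite andbF.
have i : 'I_(nw f) by apply: (Ordinal (nw_gt0 f)).
have w1 : #|wives_in (blocks A M V :\ Husband f) f| = 1.
  rewrite wE (wives_inD1 (y := Wife f i)); last by rewrite !inE /= fA eqxx.
  have := @wives_in_blocks A M V f i fA.
  by rewrite f1 => ->.
rewrite (@nb_completions_wives x0 _ f _ K) ?w1 ?mul1n //.
- by rewrite !inE eqxx.
- by rewrite !inE eqxx.
- by rewrite -card_gt0 w1 orbT.
- by rewrite outside_blocks.
Qed.

Lemma nb_completions_from_wife_couple A M V f i K : f \in couples A ->
    C (blocks (A :\ f) M V) (Husband f) = K ->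
  C (blocks A M V :\ Wife f i) (Wife f i) = K.
Proof.
rewrite inE => /andP[fA /eqP f1] HK.
rewrite (@nb_completions_couple x0 _ f i) //.
- by rewrite outside_blocks //= eqxx.
- by rewrite !inE fA.
- by rewrite !inE eqxx.
Qed.

(** Each of the [nw f] choices of the first wife leaves [(nw f).-1] wives to be arranged with the
    husband by [nb_completions_family]; the total is the factor of [f] in [weight]. *)
Lemma nb_completions_from_wife_big A M V f K : c0 \notin A -> f \in bigs A ->
    (forall i, C (blocks (A :\ f) M V) (Wife f i) = K) ->
  \sum_(i < nw f) C (blocks A M V :\ Wife f i) (Wife f i) =
  (nw f).-1 * (nw f)`! * K.
Proof.
rewrite inE => c0A /andP[fA f1] HK.
have fc0 : f != c0 by apply: contraNneq c0A => <-.
rewrite (eq_bigr (fun=> (nw f).-1 * (nw f).-1`! * K)) => [|i _].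
  rewrite sum_nat_const card_ord -[in (nw f)`!](prednK (nw_gt0 f)) factS.
  by rewrite (prednK (nw_gt0 f)); lia.
rewrite (@nb_completions_family x0 _ f _ K) ?wives_in_blocks //.
- exact: not_in_family_last.
- by rewrite !inE fA.
- by rewrite !inE eqxx.
- by rewrite /= eqxx.
- by move=> j; rewrite outside_blocks //= eqxx.
Qed.

(** Induction on the number of blocks left. No relative of [x] is waiting, so the next person has
    the sex of [x] and opens a new block; traversing it leads to a smaller instance, and the sum
    over the choices is [alternations_rec]. *)
Lemma nb_completions_blocks A M V x : c0 \notin A -> at_boundary A M V x ->
  C (blocks A M V) x = block_count A M V (is_man x).
Proof.
move: {2}(#|A| + #|M| + #|V|) (leqnn (#|A| + #|M| + #|V|)) => n.
elim: n A M V x => [|n IH] A M V x; [|rewrite leq_eqVlt => /orP[/eqP nE|]];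
  last 1 first.
- by rewrite ltnS => le; apply: IH.
- rewrite leqn0 !addn_eq0 !cards_eq0 => /andP[/andP[/eqP-> /eqP->] /eqP->] _.
  case/and4P=> _ _ hx; rewrite /block_count /weight.
  have [-> ->] : couples set0 = set0 /\ bigs set0 = set0.
    by split; apply/setP => f; rewrite !inE.
  have -> : blocks set0 set0 set0 = set0.
    by apply/setP => -[?|? ?|?|?]; rewrite !inE.
  rewrite !cards0 big_set0 nb_completions0 /= addbF => sx.
  (* With no couple left, the parity condition gives [x] and [x0] the same sex, so the circle
     closes. *)
  have -> : compatible x x0.
    rewrite /compatible (negbTE hx) sx /=.
    by case: x0 x0_c0 => //= f /eqP->; rewrite c0_couple.
  by case: ifP.
move=> c0A /and4P[xR /forall_inP xA hx sx].
have kx y : y \in blocks A M V -> ~~ kin x y.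
  move=> yR; apply/negP => kxy.
  have [f fx fy] : exists2 f, in_family f x & in_family f y.
    by case: x kxy {xR xA hx sx} => // f; [|move=> i]; exists f => //=.
  have fA : f \in A by case: y fy yR {kxy} => //= [g|g i] /eqP<-; rewrite inE.
  by have := xA f fA; rewrite fx.
have Rn0 : blocks A M V != set0.
  apply/set0Pn; have : 0 < #|A| + #|M| + #|V| by rewrite nE.
  rewrite !addn_gt0 !card_gt0 => /orP[/orP[]|] /set0Pn[z zR].
  - by exists (Husband z); rewrite inE.
  - by exists (SingleMan z); rewrite inE.
  - by exists (SingleWoman z); rewrite inE.
rewrite nb_completionsS //.
rewrite (eq_bigl (fun y => [&& y \in blocks A M V, is_man x == is_man y
                            & ~~ big_husband y])); last first.
  move=> y; case: (boolP (y \in blocks A M V)) => //= yR.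
  rewrite /next_ok compatible_across_blocks ?kx //.
  have -> : [exists z in blocks A M V, kin x z] = false.
    by apply/exists_inP => -[z /kx kz]; apply/negP.
  by rewrite andbT.
rewrite big_person.
have nextA f p : f \in A -> in_family f p -> ~~ big_husband p ->
    (is_man p == is_man x0) (+) odd #|couples (A :\ f)| ->
    C (blocks (A :\ f) M V) p = block_count (A :\ f) M V (is_man p).
  move=> fA fp hp sp; rewrite IH //.
  - by move: nE; rewrite (cardsD1 f A) fA add1n !addSn => -[->].
  - by rewrite !inE negb_and c0A orbT.
  apply/and4P; split=> //.
  - by case: p fp {hp sp} => //= [g|g i] /eqP gf; rewrite inE gf !inE eqxx.
  - apply/forall_inP => g; rewrite !inE => /andP[gf _].
    by case: p fp {hp sp} => //= [h|h i] /eqP->; rewrite eq_sym.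
(* A couple is left at the other sex, so the two kinds are exchanged; the change of sex and the loss
   of one couple cancel in the parity condition. *)
have nextC f p : f \in couples A -> in_family f p -> is_man p = ~~ is_man x ->
    C (blocks (A :\ f) M V) p =
    weight A * if is_man x
             then alternations #|couples A|.-1 (#|bigs A| + #|V|) #|M|
             else alternations #|couples A|.-1 #|M| (#|bigs A| + #|V|).
  move=> fA fp px; have := fA; rewrite inE => /andP[fA' /eqP f1].
  rewrite nextA //.
  - rewrite /block_count px weight_couple // couplesD1 bigsD1.
    rewrite couple_notin_bigs // (cardsD1 f (couples A)) fA.
    by case: (is_man x).
  - by case: p fp {px} => //= g /eqP->; rewrite f1.
  rewrite px couplesD1; move: sx; rewrite (cardsD1 f (couples A)) fA /=.
  by case: (is_man x); case: (is_man x0); case: (odd _).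
have nextM i : i \in M -> is_man x ->
    C (blocks A M V :\ SingleMan i) (SingleMan i) =
    weight A * alternations #|couples A| #|M|.-1 (#|bigs A| + #|V|).
  move=> iM mx; have ME := cardsD1 i M; rewrite iM add1n in ME.
  rewrite blocksD1_man IH //; first by rewrite /block_count /= ME.
    by move: nE; rewrite ME addnS addSn => -[->].
  apply/and4P; split=> //; rewrite ?inE ?eqxx //.
    by apply/forall_inP.
  by move: sx; rewrite mx.
have nextV i : i \in V -> ~~ is_man x ->
    C (blocks A M V :\ SingleWoman i) (SingleWoman i) =
    weight A * alternations #|couples A| (#|bigs A| + #|V|.-1) #|M|.
  move=> iV mx; have VE := cardsD1 i V; rewrite iV add1n in VE.
  rewrite blocksD1_woman IH //; first by rewrite /block_count /= VE.
    by move: nE; rewrite VE addnS => -[->].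
  apply/and4P; split=> //; rewrite ?inE ?eqxx //.
    by apply/forall_inP.
  by move: sx; rewrite (negbTE mx).
(* Every family is a couple or big, so some block is left, as [alternations_rec] requires. *)
have acc : 0 < #|couples A| + #|M| + (#|bigs A| + #|V|).
  have AE : #|A| <= #|couples A| + #|bigs A|.
    apply: leq_trans (leq_card_setU _ _); apply/subset_leq_card/subsetP => f fA.
    by rewrite !inE fA /= [nw f == 1]eq_sym -leq_eqVlt nw_gt0.
  rewrite addnACA (leq_trans _ (leq_add AE (leqnn _))) //.
  by rewrite addnA nE.
(* After a man come husbands of couples and single men; after a woman, wives of couples or of big
   families and single women. *)
case mx: (is_man x) sx nextC nextM nextV => /= sx nextC nextM nextV.
  rewrite [X in _ + X + _ + _]big1 => [|f _]; last first.
    by rewrite big_pred0 // => i; rewrite andbF.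
  rewrite [X in _ + X]big1 => [|i]; last by rewrite andbF.
  rewrite !addn0.
  rewrite (eq_big (mem (couples A)) (fun=> weight A *
      alternations #|couples A|.-1 (#|bigs A| + #|V|) #|M|)); first last.
  - move=> f; rewrite !inE /= -leqNgt => /andP[fA f1].
    have fc : f \in couples A by rewrite inE fA eqn_leq f1 nw_gt0.
    apply: nb_completions_from_husband => // i.
    by rewrite (nextC f) //= eqxx.
  - move=> f; rewrite !inE /= -leqNgt eqn_leq nw_gt0 andbT.
    by case: (f \in A).
  rewrite (eq_big (mem M) (fun=> weight A *
      alternations #|couples A| #|M|.-1 (#|bigs A| + #|V|))); first last.
  - by move=> i; rewrite !inE andbT => iM; apply: nextM.
  - by move=> i; rewrite !inE andbT.
  rewrite !sum_nat_const /block_count.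
  rewrite (alternations_rec acc) mulnDr.
  by rewrite ![weight A * (_ * _)]mulnCA.
rewrite [X in X + _ + _ + _]big1 => [|i]; last by rewrite andbF.
rewrite [X in _ + X + _]big1 => [|i]; last by rewrite andbF.
rewrite add0n addn0.
rewrite [X in _ + X](eq_big (mem V) (fun=> weight A *
    alternations #|couples A| (#|bigs A| + #|V|.-1) #|M|)); first last.
- by move=> i; rewrite !inE andbT => iV; apply: nextV.
- by move=> i; rewrite !inE andbT.
pose Kc := weight A * alternations #|couples A|.-1 #|M| (#|bigs A| + #|V|).
pose Kb := weight A * alternations #|couples A| (#|bigs A|.-1 + #|V|) #|M|.
transitivity (\sum_(f in couples A) Kc + \sum_(f in bigs A) Kb + #|V| *
  (weight A * alternations #|couples A| (#|bigs A| + #|V|.-1) #|M|)).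
  congr (_ + _); last by rewrite sum_nat_const.
  rewrite (big_mkcond (mem (couples A))) (big_mkcond (mem (bigs A))).
  rewrite -big_split /=; apply: eq_bigr => f _.
  have [fA|fA] := boolP (f \in A); last first.
    by rewrite big_pred0 => [|i]; rewrite !inE (negbTE fA).
  rewrite (eq_bigl xpredT) => [|i]; last by rewrite inE fA.
  have [fc|fc] := boolP (f \in couples A).
    have := fc; rewrite inE fA /= => /eqP f1.
    rewrite (eq_bigr (fun=> Kc)) => [|i _].
      by rewrite sum_nat_const card_ord inE f1 andbF addn0 mul1n.
    apply: nb_completions_from_wife_couple => //.
    by rewrite (nextC f) //= eqxx.
  have fb : f \in bigs A.
    have := nw_gt0 f; rewrite inE fA leq_eqVlt eq_sym.
    by move: fc; rewrite inE fA /= => /negbTE->.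
  rewrite fb add0n /Kb (weightD1 fb) -mulnA.
  apply: nb_completions_from_wife_big => // i.
  rewrite (nextA f) //= ?eqxx //.
    rewrite /block_count couplesD1 bigsD1 big_notin_couples //.
    by rewrite (cardsD1 f (bigs A)) fb.
  by rewrite couplesD1 big_notin_couples.
rewrite !sum_nat_const /block_count.
rewrite addnAC in acc; rewrite (alternations_rec acc) /Kc /Kb.
(* The recurrence treats big families and single women as one kind; its factor is split between
   them. *)
have -> : (#|bigs A| + #|V|) *
    alternations #|couples A| (#|bigs A| + #|V|).-1 #|M|
  = #|bigs A| * alternations #|couples A| (#|bigs A|.-1 + #|V|) #|M|
  + #|V| * alternations #|couples A| (#|bigs A| + #|V|.-1) #|M|.
  rewrite mulnDl; congr (_ + _).
    by case: #|bigs A|.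
  by case: #|V| => // v; rewrite addnS.
by rewrite !mulnDr !addnA ![weight A * (_ * _)]mulnCA.
Qed.

End BlockCount.

End Counting.

(** * From seatings to lists *)
Section Seatings.

Variables (F : finType) (nw : F -> nat) (m w : nat).
Hypothesis nw_gt0 : forall f, 0 < nw f.

Local Notation person := (person nw m w).

Implicit Types (p q x y : person) (f g : F) (R : {set person}).

Variable c0 : F.
Hypotheses (c0_couple : nw c0 = 1) (many : 2 < #|{: person}|).

Implicit Types s : seating person.

Local Notation admissible := (admissible_seatings nw m w).

Lemma compatibleC p q : compatible p q = compatible q p.
Proof.
by rewrite /compatible [is_man q == _]eq_sym orbC [X in _ && X]andbC.
Qed.

Lemma admissibleE s : (s \in admissible) =
  [&& injectiveb s, families_together s
    & [forall p, forall q, adjacent s p q ==> compatible p q]].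
Proof.
rewrite inE; congr [&& _, _ & _].
apply/andP/forallP => [[/forallP own /forallP surr] p|adj].
  have ownP q r : adjacent s q r -> is_man q -> ~~ is_man r -> wife_of r q.
    move=> qr mq wr; have /forallP/(_ r) := own q.
    by rewrite mq /is_woman wr qr.
  have surrP q r : adjacent s q r -> big_husband q -> wife_of r q.
    case: q => // f qr f1; have := surr f.
    rewrite (f1 : 1 < nw f) => /forallP/(_ r).
    by rewrite qr.
  apply/forallP => q; apply/implyP => pq.
  have qp := pq; rewrite adjacentC in qp.
  apply/and3P; split; apply/implyP; last 2 first; try exact: surrP.
  case mp: (is_man p); case mq: (is_man q) => // _; apply/orP.
    by right; apply: ownP pq _ _; rewrite ?mq.
  by left; apply: ownP qp _ _; rewrite ?mp.
have adjP p q : adjacent s p q -> compatible p q.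
  by have /forallP/(_ q)/implyP := adj p.
split.
  apply/forallP => p; apply/forallP => q; apply/implyP => /and3P[mp wq /adjP].
  rewrite /compatible mp (negbTE wq) /= => /andP[/orP[pq|//] _].
  by case: p mp pq => [f|f i|i|i] //; case: (q).
apply/forallP => f; apply/implyP => f1; apply/forallP => q; apply/implyP.
by move/adjP; rewrite /compatible /= f1 => /and3P[].
Qed.

Lemma admissible_rotate s k : s \in admissible -> rotate s k \in admissible.
Proof.
rewrite !admissibleE => /and3P[/injectiveP sI /forallP sF /forallP sA].
apply/and3P; split.
- by apply/injectiveP => p q; rewrite !ffunE => /iter_ordS_inj/sI.
- by apply/forallP => f; apply: consecutive_rotate.
- apply/forallP => p; apply/forallP => q; rewrite adjacent_rotate.
  by have /forallP := sA p.
Qed.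

(* Since c0 is a couple, its members then occupy exactly the seats 0 and 1. *)
Definition normalized : {set seating person} :=
  [set s in admissible | [forall p, in_family c0 p ==> (s p < 2)]].

Lemma card_family f : #|[set p : person | in_family f p]| = (nw f).+1.
Proof.
have -> : [set p : person | in_family f p] =
          Husband f |: [set Wife f i | i in [set: 'I_(nw f)]].
  apply/setP => p; rewrite !inE in_familyP; congr (_ || _).
  apply/idP/imsetP => [/wife_ofP[i ->]|[i _ ->]]; first by exists i.
  by rewrite /= eqxx.
rewrite cardsU1 card_imset ?cardsT ?card_ord.
  by case: imsetP => [[]|].
by move=> j k [] /eqP; rewrite eq_Tagged => /eqP.
Qed.

Lemma normalize s : s \in admissible -> exists k, rotate s k \in normalized.
Proof.
move=> sD; have := sD; rewrite admissibleE => /and3P[/injectiveP sI].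
move=> /forallP/(_ c0)/existsP[a /eqP sF] _.
(* The arc of [c0] starts at seat [a], which this rotation carries to seat 0. *)
exists (#|{: person}| - a); rewrite inE admissible_rotate //=.
apply/forallP => p; apply/implyP => pc.
have : s p \in s @: [set p | in_family c0 p] by apply: imset_f; rewrite inE.
rewrite val_rotate sF => /imsetP[j _ ->] {sF}.
have j2 : j < 2.
  by rewrite (leq_trans (ltn_ord j)) // card_imset // card_family c0_couple.
rewrite val_iter_ordS modnDml addnAC subnKC; last exact: ltnW.
by rewrite modnDl modn_small // (leq_trans j2) // ltnW.
Qed.

(** A rotation that keeps seat 0 within the seats 0 and 1 is by 0 or by 1; by 1 it would carry seat
    1 to seat 2, which is a different seat since [many] holds. *)
Lemma normalized_rotate s k :
  s \in normalized -> rotate s k \in normalized -> rotate s k = s.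
Proof.
rewrite !inE => /andP[/and4P[/injectiveP sI _ _ _] /forallP s2].
move=> /andP[_ /forallP r2]; apply: rotate_id.
have i : 'I_(nw c0) by apply: (Ordinal (nw_gt0 c0)).
have := r2 (Husband c0); have := r2 (Wife c0 i).
have := s2 (Husband c0); have := s2 (Wife c0 i).
have : s (Husband c0) != s (Wife c0 i) by apply/eqP => /sI.
rewrite /= !val_rotate !eqxx -val_eqE /= /dvdn -!(modnDmr _ k).
have := ltn_pmod k (ltn_trans (isT : 0 < 2) many); clear r2 s2.
move: (k %% _) (s (Husband c0) : nat) (s (Wife c0 i) : nat) => {}k.
move: many; move: #|_| => N N2 [|[|h]] [|[|v]] // kN _ _ _.
all: rewrite ?add0n ?(modn_small kN) => r1 r0.
all: by case: k kN r1 r0 => [|[|k]] //; rewrite addn1 (modn_small N2).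
Qed.

(** The normalized seatings form a transversal of the rotation classes: [normalize] gives existence,
    [normalized_rotate] uniqueness. *)
Lemma nb_seatings_normalized : nb_seatings nw m w = #|normalized|.
Proof.
have P_gt0 : 0 < #|{: person}| by apply: ltn_trans many.
have eqv : {in admissible & &, equivalence_rel (@same_up_to_rotation person)}.
  by move=> s t u _ _ _; apply: same_up_to_rotation_equiv.
apply/esym/card_transversal; apply/and3P; split.
- exact: equivalence_partitionP eqv.
- by apply/subsetP => s; rewrite inE => /andP[].
apply/forall_inP => B /imsetP[s sD ->]; have [k sk] := normalize sD.
apply/cards1P; exists (rotate s k); apply/setP => t.
rewrite in_setI in_set1 [X in _ && X]in_set.
apply/andP/eqP => [[tN /andP[_ /(same_up_to_rotationP _ _ P_gt0)[l tE]]]|->].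
  have [j jk] := rotate_back s k.
  rewrite tE -[in RHS](@normalized_rotate _ (j + l) sk) //.
    by rewrite -rotateD jk.
  by rewrite -rotateD jk -tE.
split=> //; rewrite admissible_rotate //; apply/same_up_to_rotationP => //.
by exists k.
Qed.

(** Only the head is asked to belong to [c0]; contiguity puts the other member second. *)
Definition round_list (t : seq person) : bool :=
  [&& uniq t, cycle (@compatible F nw m w) t, grouped (@kin F nw m w) t
    & in_family c0 (head (Husband c0) t)].

Lemma kin_nth x0 (t : seq person) i j f : in_family f (nth x0 t i) ->
  kin (nth x0 t i) (nth x0 t j) = in_family f (nth x0 t j).
Proof. by move=> /in_family_kin ->. Qed.

Lemma kinP p q :
  reflect (exists2 f, in_family f p & in_family f q) (kin p q).
Proof.
apply: (iffP idP) => [|[f /in_family_kin -> //]].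
by case: p => //= f; [|move=> i]; exists f => //=.
Qed.

(** [t] lists the persons seat by seat, so adjacency becomes [cycle]. As [c0] fills the seats 0 and
    1, no family holds both seat 0 and the last seat; hence no family wraps around, and arcs become
    intervals of the list. *)
Lemma normalized_round_list
    (s : seating person) (t : #|{: person}|.-tuple person) :
    uniq t -> (forall p, index p t = s p) ->
  (s \in normalized) = round_list t.
Proof.
move=> tU ts; pose x0 : person := Husband c0.
have t_s p : tnth t (s p) = p.
  rewrite (tnth_nth x0) -ts nth_index // -index_mem ts size_tuple.
  exact: ltn_ord.
have s_t i : s (tnth t i) = i.
  by apply: ord_inj; rewrite -ts (tnth_nth x0) index_uniq // size_tuple.
have sI : injective s by apply: can_inj t_s.
have P_gt0 : 0 < #|{: person}| by apply: ltn_trans many.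
have memF f i : (i \in s @: [set p | in_family f p]) = in_family f (tnth t i).
  apply/imsetP/idP => [[p]|fi]; first by rewrite inE => fp ->; rewrite t_s.
  by exists (tnth t i); rewrite ?inE ?s_t.
have compatE : [forall p, forall q, adjacent s p q ==> compatible p q] =
               cycle (@compatible F nw m w) t.
  apply/forallP/cycle_tupleP => [adj i|cyc p].
    have /forallP/(_ (tnth t (ordS i))) := adj (tnth t i).
    by rewrite /adjacent !s_t eqxx.
  apply/forallP => q; apply/implyP => /orP[] /eqP sE.
    by have := cyc (s p); rewrite -sE !t_s.
  by have := cyc (s q); rewrite -sE !t_s compatibleC.
have convexE : grouped (@kin F nw m w) t <-> 
    forall f, convex_seats (s @: [set p | in_family f p]).
  split=> [/(groupedP _ x0) gr f i j k|cv].
    rewrite !memF !(tnth_nth x0) => fi fj ij ->.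
    rewrite -(kin_nth _ fi); apply: (gr i j); last by rewrite (kin_nth _ fi).
    by rewrite ij size_tuple ltn_ord.
  apply/(groupedP _ x0) => i j /andP[ij]; rewrite size_tuple => jn.
  have i1n := leq_ltn_trans ij jn; have iN := ltn_trans ij jn.
  move=> /kinP[f fi fj]; rewrite (kin_nth _ fi).
  have := cv f (Ordinal iN) (Ordinal jn) (Ordinal i1n).
  by rewrite !memF !(tnth_nth x0); apply.
rewrite inE admissibleE compatE /round_list tU /= (introT (injectiveP s) sI) /=.
have headE : head x0 t = tnth t (Ordinal P_gt0) by rewrite (tnth_nth x0) nth0.
rewrite headE -/x0.
apply/andP/and3P => [[/andP[/forallP tog ->] /forallP s2]|[-> /convexE cv hc]].
  have F0 : s @: [set p | in_family c0 p] = [set i : 'I_#|{: person}| | i < 2].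
    apply/eqP; rewrite eqEcard; apply/andP; split.
      apply/subsetP => i /imsetP[p]; rewrite inE => pc ->.
      by have := s2 p; rewrite pc inE.
    rewrite card_imset // card_family c0_couple.
    rewrite cardE -(size_map val) -[2](size_iota 0); apply: uniq_leq_size.
      by rewrite map_inj_uniq ?enum_uniq //; apply: val_inj.
    by move=> v /mapP[i]; rewrite mem_enum inE mem_iota => i2 ->.
  have memc i : in_family c0 (tnth t i) = (i < 2) by rewrite -memF F0 inE.
  split=> //.
  apply/convexE => f; apply: consecutive_convex (tog f) => i j i0 jN.
  rewrite !memF; apply/negP => /andP[fi fj].
  have /negP : ~~ in_family c0 (tnth t j) by rewrite memc -leqNgt -ltnS jN.
  have : in_family c0 (tnth t i) by rewrite memc i0.
  move=> ci []; have <- // : f = c0.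
  by case: (tnth t i) fi ci => //= [g|g k] /eqP <- /eqP.
split.
  rewrite andbT; apply/forallP => f; apply: convex_consecutive (cv f).
  by apply/set0Pn; exists (s (Husband f)); rewrite memF t_s /= eqxx.
have N1 : 1 < #|{: person}| := ltnW many.
(* The other member of [c0] sits beyond seat 0, so convexity puts seat 1 into [c0]. *)
have c1 : in_family c0 (tnth t (Ordinal N1)).
  have [p [pc p0]] : exists p, in_family c0 p /\ p != tnth t (Ordinal P_gt0).
    have i : 'I_(nw c0) by apply: (Ordinal (nw_gt0 c0)).
    case E : (tnth t (Ordinal P_gt0)) hc => [f|f j|j|j] //= /eqP fc.
      by exists (Wife c0 i); rewrite /= eqxx.
    by exists (Husband c0); rewrite /= eqxx.
  rewrite -memF; apply: (cv c0 (Ordinal P_gt0) (s p)); rewrite ?memF ?t_s //.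
  rewrite lt0n; apply: contra p0 => /eqP sp0.
  by rewrite -[p in p == _]t_s; apply/eqP; congr tnth; apply: val_inj.
apply/forallP => p; apply/implyP => pc.
have sub : [set tnth t (Ordinal P_gt0); tnth t (Ordinal N1)] =
           [set p | in_family c0 p].
  apply/eqP; rewrite eqEcard; apply/andP; split.
    by apply/subsetP => q; rewrite !inE => /orP[] /eqP ->.
  by rewrite card_family c0_couple cards2 (inj_eq (can_inj s_t)).
have : p \in [set p | in_family c0 p] by rewrite inE.
by rewrite -sub !inE => /orP[] /eqP ->; rewrite s_t.
Qed.

Lemma card_normalized :
  #|normalized| = #|[set t : #|{: person}|.-tuple person | round_list t]|.
Proof.
have P_gt0 : 0 < #|{: person}| by apply: ltn_trans many.
(* The default seat serves only a person missing from [t]; a duplicate-free [t] of this length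
   misses nobody. *)
pose seat (t : #|{: person}|.-tuple person) : seating person :=
  [ffun p => insubd (Ordinal P_gt0) (index p t)].
have seatE (t : #|{: person}|.-tuple person) p : uniq t -> index p t = seat t p.
  move=> tU; rewrite ffunE val_insubd -[X in _ < X](size_tuple t) index_mem.
  have tT : t =i predT.
    by apply/subset_cardP; [rewrite (card_uniqP tU) size_tuple | apply/subsetP].
  by rewrite tT.
have -> :
    normalized = seat @: [set t : #|{: person}|.-tuple person | round_list t].
  apply/setP => s; apply/idP/imsetP => [sN|[t]]; last first.
    rewrite inE => tR ->; have tU : uniq t by case/and4P: tR.
    by rewrite (normalized_round_list tU) // => p; apply: seatE.
  have sI : injective s.
    by move: sN; rewrite inE admissibleE => /andP[/and3P[/injectiveP]].
  have [h sh hs] : bijective s by apply: inj_card_bij; rewrite ?card_ord.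
  pose t := [tuple h i | i < #|{: person}|].
  have tU : uniq t by rewrite map_inj_uniq ?enum_uniq //; apply: can_inj hs.
  have ts p : index p t = s p.
    have -> : p = nth p t (s p) by rewrite -tnth_nth tnth_mktuple sh.
    by rewrite index_uniq ?size_tuple // -tnth_nth tnth_mktuple sh.
  exists t; first by rewrite inE -(@normalized_round_list s t tU).
  by apply/ffunP => p; apply: ord_inj; rewrite -seatE // ts.
rewrite card_in_imset // => t u; rewrite !inE.
move=> /and4P[tU _ _ _] /and4P[uU _ _ _].
move=> tu; apply: eq_from_tnth => i.
have := seatE u (tnth t i) uU; rewrite -tu -seatE //.
rewrite [index _ t](_ : _ = i :> nat); last first.
  by rewrite (tnth_nth (tnth t i)) index_uniq ?size_tuple.
move=> iE; rewrite [RHS](tnth_nth (tnth t i)) -iE nth_index //.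
by rewrite -index_mem iE size_tuple.
Qed.

(** The head [x] both starts the list and closes the circle, hence it also appears as [last]. *)
Lemma card_round_list :
  #|[set t : #|{: person}|.-tuple person | round_list t]| =
  \sum_(x | in_family c0 x)
    nb_completions (@compatible F nw m w) (@kin F nw m w) x (setT :\ x) x.
Proof.
have cardD1 x : #|{: person}| = #|[set: person] :\ x|.+1.
  by rewrite -cardsT (cardsD1 x) inE.
rewrite /nb_completions; move: (#|{: person}|) cardD1 => N cardD1.
(* A common name for these cardinals makes the tuple types independent of [x]. *)
have {}cardD1 : exists n, N = n.+1 /\ forall x, #|[set: person] :\ x| = n.
  exists N.-1; have := cardD1 (Husband c0) => ->; split=> // x.
  by have := cardD1 x; rewrite (cardD1 (Husband c0)) => -[].
case: cardD1 => n [-> cardD1].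
under eq_bigr => x _ do rewrite cardD1.
pose Q x (t : seq person) := in_family c0 x &&
  completion (@compatible F nw m w) (@kin F nw m w) x (setT :\ x) x t.
transitivity #|[set t : n.+1.-tuple person | Q (thead t) (behead t)]|.
  apply: eq_card => t; rewrite !inE; case/tupleP: t => x t; rewrite theadE.
  rewrite /round_list /Q /completion [in RHS]/= [RHS]andbC.
  suff -> : uniq (x :: t) = uniq t && ([set:: t] == setT :\ x).
    by rewrite -!andbA.
  rewrite /= andbC; case tU: (uniq t) => //=.
  apply/idP/eqP => [xt|/setP/(_ x)]; last by rewrite !inE eqxx => ->.
  apply/eqP; rewrite eqEcard cardD1 cardsE (card_uniqP tU) size_tuple.
  rewrite leqnn andbT.
  by apply/subsetP => y; rewrite !inE andbT => yt; apply: contraNneq xt => <-.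
rewrite card_cons_tuple [RHS]big_mkcond; apply: eq_bigr => x _.
by rewrite /Q; case: ifP => xc; [|rewrite eq_card0 // => t; rewrite inE].
Qed.

End Seatings.

(** * The general formula and its specialisation *)

(** The list starts with the husband or with the wife of [c0], whence two summands. An odd number of
    couples remains after [c0], so the sex is back to that of the first person when the circle
    closes. *)
Theorem nb_seatings_families (F : finType) (nw : F -> nat) (m w : nat) :
    (forall f, 0 < nw f) -> 0 < #|couples nw setT| ->
    ~~ odd #|couples nw setT| ->
  nb_seatings nw m w = weight nw setT *
    (alternations #|couples nw setT|.-1 (#|bigs nw setT| + w) m +
     alternations #|couples nw setT|.-1 m (#|bigs nw setT| + w)).
Proof.
move=> nw_gt0 /card_gt0P[c0 c0C] ev.
have c0_couple : nw c0 = 1 by move: c0C; rewrite inE => /andP[_ /eqP].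
(* Evenness yields a second couple; its husband and the two members of [c0] are three persons. *)
have many : 2 < #|{: person nw m w}|.
  have [c1 c10] : exists c1, c1 != c0.
    apply/existsP; move: ev; rewrite (cardsD1 c0) c0C.
    have [->|/set0Pn[f]] := eqVneq (couples nw setT :\ c0) set0.
      by rewrite cards0.
    by rewrite !inE => /andP[fc _] _; apply/existsP; exists f.
  rewrite -[3]/(1.+2) -{1}c0_couple -(@card_family F nw m w c0) -add1n.
  rewrite -[X in X + _](cards1 (Husband c1 : person nw m w)) -cardsUI.
  rewrite (_ : _ :&: _ = set0) ?cards0 ?addn0 ?max_card //.
  apply/setP => p; rewrite !inE; case: eqP => //= ->.
  by rewrite /= (negbTE c10).
rewrite (nb_seatings_normalized nw_gt0 c0_couple many).
rewrite (card_normalized nw_gt0 c0_couple many) card_round_list.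
have RE : [set: person nw m w] = blocks nw setT setT setT.
  by apply/setP => -[?|? ?|?|?]; rewrite !inE.
have count x x0 : in_family c0 x -> in_family c0 x0 -> is_man x != is_man x0 ->
    nb_completions (@compatible F nw m w) (@kin F nw m w) x0
      (blocks nw (setT :\ c0) setT setT) x =
    weight nw setT *
    if is_man x then alternations #|couples nw setT|.-1 m (#|bigs nw setT| + w)
    else alternations #|couples nw setT|.-1 (#|bigs nw setT| + w) m.
  move=> xc x0c xx0; rewrite (nb_completions_blocks nw_gt0 c0_couple x0c).
  - rewrite /block_count weight_couple // couplesD1 bigsD1 couple_notin_bigs //.
    by rewrite !cardsT !card_ord (cardsD1 c0 (couples nw setT)) c0C.
  - by rewrite !inE eqxx.
  apply/and4P; split.
  - by case: x xc {xx0} => //= [g|g i] /eqP gc; rewrite inE gc !inE eqxx.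
  - apply/forall_inP => f; rewrite !inE andbT => fc.
    by case: x xc {xx0} => //= [g|g i] /eqP->; rewrite eq_sym.
  - by case: x xc {xx0} => //= g /eqP->; rewrite c0_couple.
  rewrite couplesD1 (negbTE xx0) /=.
  by move: ev; rewrite (cardsD1 c0) c0C /= negbK.
rewrite big_person RE mulnDr.
rewrite [X in _ + _ + X + _]big_pred0 // [X in _ + X]big_pred0 // !addn0.
congr (_ + _).
  rewrite (big_pred1 c0) => [|f]; last by [].
  apply: (nb_completions_from_husband nw_gt0) => // i.
  by rewrite count //= eqxx.
rewrite (bigD1 c0) //= [X in _ + X]big1 ?addn0 => [|f fc]; last first.
  by rewrite big_pred0 // => i; rewrite (negbTE fc).
rewrite (eq_bigl xpredT) => [|i]; last by rewrite eqxx.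
rewrite (eq_bigr (fun=> weight nw setT *
    alternations #|couples nw setT|.-1 m (#|bigs nw setT| + w))) => [|i _].
  by rewrite sum_nat_const card_ord c0_couple mul1n.
apply: nb_completions_from_wife_couple => //.
by rewrite count //= eqxx.
Qed.

(** An odd number of couples leaves [k.+1] runs of each kind, so the value is symmetric in [o] and
    [u] and the two summands agree. *)
Lemma alternations_odd (k o u : nat) :
  alternations k.*2.+1 o u = (k.*2.+1)`! * (k + o) ^_ o * (k + u) ^_ u.
Proof. by rewrite /alternations /= doubleK uphalf_double. Qed.

(** With [n2] equal to [k.+1.*2], this absorbs the factor 2 of the two equal summands into the
    quotient of the formula, by (k+1)! = (k+1) k! and (2k+2)! = 2(k+1) (2k+1)!. *)
Lemma fact_double (k : nat) :
  (k.+1.*2)`! %/ k.+1`! * k`! = 2 * (k.*2.+1)`!.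
Proof.
apply/eqP; rewrite -(eqn_pmul2l (ltn0Sn k)) mulnCA -factS divnK.
  by rewrite doubleS factS -[_.*2.+2]doubleS -muln2 mulnA.
by rewrite -addnn -(ffact_fact (leq_addl k.+1 k.+1)) addnK dvdn_mull.
Qed.

Theorem theorem1p1 (n2 n3 n4 n5 m w : nat) (n2_even : ~~ odd n2)
    (n2_ge2 : 2 <= n2) :
  nb_seatings (@nb_wives n2 n3 n4 n5) m w =
  (1 * 2`!) ^ n3 * (2 * 3`!) ^ n4 * (3 * 4`!) ^ n5
  * (n2`! %/ (n2 %/ 2)`!)
  * ((n2 %/ 2 + m - 1)`! %/ (n2 %/ 2 - 1)`!)
  * (n2 %/ 2 + n3 + n4 + n5 + w - 1)`!.
Proof.
have couplesE : #|couples (@nb_wives n2 n3 n4 n5) setT| = n2.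
  rewrite -sum1_card (eq_bigl (fun f => @nb_wives n2 n3 n4 n5 f == 1)).
    rewrite /household !big_sumType /=.
    do 3 rewrite [X in _ + X]big_pred0 // addn0.
    by rewrite sum1_card card_ord.
  by move=> f; rewrite !inE.
have bigsE (f : household n2 n3 n4 n5) :
    (f \in bigs (@nb_wives n2 n3 n4 n5) setT) = (1 < nb_wives f).
  by rewrite !inE.
have card_bigs : #|bigs (@nb_wives n2 n3 n4 n5) setT| = n3 + n4 + n5.
  rewrite -sum1_card (eq_bigl _ _ bigsE) /household !big_sumType /=.
  by rewrite big_pred0 // !sum1_card !card_ord.
have weightE : weight (@nb_wives n2 n3 n4 n5) setT =
    (1 * 2`!) ^ n3 * (2 * 3`!) ^ n4 * (3 * 4`!) ^ n5.
  rewrite /weight (eq_bigl _ _ bigsE) /household !big_sumType /=.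
  by rewrite big_pred0 // mul1n !prod_nat_const !card_ord.
have n2E : n2 = (n2./2).-1.+1.*2.
  by rewrite prednK ?half_gt0 // even_halfK.
rewrite nb_seatings_families ?couplesE ?card_bigs ?weightE //; last first.
- exact: ltnW.
- by case=> [[[]|]|].
move: (n2./2).-1 n2E => k ->.
rewrite divn2 doubleK doubleS /= !alternations_odd.
rewrite addSn !subn1 /= -doubleS.
rewrite (_ : (k + m)`! %/ k`! = (k + m) ^_ m); last first.
  by rewrite ffact_factd ?leq_addl // addnK.
rewrite -!(addnA k).
(* The last factorial splits into [(k + b) ^_ b] and the factorial of [k], the one that
   [fact_double] uses up. *)
move: (n3 + n4 + n5 + w) => b; rewrite -(ffact_fact (leq_addl k b)) addnK.
have := fact_double k.
move: (_ %/ _) (k`!) ((k.*2.+1)`!) ((k + m) ^_ m) ((k + b) ^_ b).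
move=> x y a c d xy.
move: (_ ^ n3 * _ * _) => W.
transitivity (W * (x * y) * (c * d)); last by lia.
by rewrite xy; lia.
Qed.
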